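(* Let $q\in\Bbbk^\times$ with $q\neq 1$, and let $A=\Bbbk\langle a,c\mid ac-qca-1\rangle$ be the quantum Weyl algebra, viewed as a skew polynomial ring $A=\Bbbk[c][a;\sigma_1,\delta_1]$ with $\sigma_1(c)=qc$, $\delta_1(c)=1$. If $P=A[d;\sigma_2,\delta_2]$ is an involutive skew polynomial extension (ISPE) of $\Bbbk[c]$, then $q=-1$ and $P$ has relations $ac+ca=1$, $dc+cd=1$, $da+ad=h$ with $h\in\Bbbk[c]$.
   Context: $\Bbbk$ is an algebraically closed field of characteristic zero. For an automorphism $\sigma$ of a ring $R$, a $\sigma$-derivation is a $\Bbbk$-linear map $\delta:R\to R$ with $\delta(rs)=\sigma(r)\delta(s)+\delta(r)s$; the skew polynomial ring $R[x;\sigma,\delta]$ has commutation rule $xr=\sigma(r)x+\delta(r)$ for $r\in R$. An involutive skew polynomial extension (ISPE) of $R$ is an iterated skew polynomial ring $S=R[a;\sigma_1,\delta_1][d;\sigma_2,\delta_2]$ (with $\sigma_2$ an automorphism of, and $\delta_2$ a $\sigma_2$-derivation on, $R[a;\sigma_1,\delta_1]$) for which there is an automorphism $\tau$ of $S$ with $\tau(a)=d$, $\tau(d)=a$ and $\tau(r)=r$ for all $r\in R$. *)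

(* Defs.v *)
From HB Require Import structures.
From mathcomp Require Import all_boot all_order all_algebra.

Set Implicit Arguments.
Unset Strict Implicit.
Unset Printing Implicit Defensive.

Import GRing.Theory.
Local Open Scope ring_scope.

(* MathComp has no skew polynomial rings and no free noncommutative algebras
   with their quotients by relations, so R[x; sigma, delta] is described
   internally (a ring over R that is free as a left R-module on the powers of
   x, with the commutation rule) and k<X | rels> by its universal property. *)

Definition skew_derivation (k : fieldType) (R : algType k)
    (sigma : {rmorphism R -> R}) (delta : {linear R -> R}) : Prop :=
  forall r s : R, delta (r * s) = sigma r * delta s + delta r * s.

(* S = R[x; sigma, delta], where [iota] embeds R in S.  Since [horner] puts
   coefficients on the left, [(map_poly iota p).[x]] is the sum of the
   iota p`_i * x ^+ i, and the bijectivity clause says that the powers of x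
   form a basis of S as a left R-module; in particular iota is injective.
   As S is a k-algebra, its scalars commute with x, so the commutation rule
   makes sigma k-linear even though it is only assumed to be a ring
   automorphism. *)
Record skew_poly_ring (k : fieldType) (R S : algType k)
    (iota : {lrmorphism R -> S}) (x : S)
    (sigma : {rmorphism R -> R}) (delta : {linear R -> R}) : Prop :=
  SkewPolyRing {
    skew_aut   : bijective sigma;
    skew_der   : skew_derivation sigma delta;
    skew_basis : bijective (fun p : {poly R} => (map_poly iota p).[x]);
    skew_comm  : forall r : R, x * iota r = iota (sigma r) * x + iota (delta r)
  }.

(* S = R[a; sigma1, delta1][d; sigma2, delta2] is an ISPE of R, with
   intermediate ring A = R[a; sigma1, delta1]. *)
Record ispe (k : fieldType) (R A S : algType k)
    (iA : {lrmorphism R -> A}) (a : A)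
    (sigma1 : {rmorphism R -> R}) (delta1 : {linear R -> R})
    (iS : {lrmorphism A -> S}) (d : S)
    (sigma2 : {rmorphism A -> A}) (delta2 : {linear A -> A}) : Prop :=
  Ispe {
    ispe_inner : skew_poly_ring iA a sigma1 delta1;
    ispe_outer : skew_poly_ring iS d sigma2 delta2;
    ispe_invol : exists tau : {rmorphism S -> S},
      [/\ bijective tau, tau (iS a) = d, tau d = iS a
        & forall r : R, tau (iS (iA r)) = iS (iA r)]
  }.

Definition qweyl_relation (k : fieldType) (q : k) (B : algType k)
    (a c : B) : Prop :=
  a * c - q *: (c * a) - 1 = 0.

(* A = k<a, c | ac - qca - 1>.  In this and the next presentation, leaving out
   the zero ring as a target (an algType is nontrivial) changes nothing: it
   receives exactly one map from any algebra. *)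
Definition quantum_weyl (k : fieldType) (q : k) (A : algType k)
    (a c : A) : Prop :=
  qweyl_relation q a c /\
  forall (B : algType k) (u v : B), qweyl_relation q u v ->
    exists f : {lrmorphism A -> B},
      (f a = u /\ f c = v) /\
      forall g : {lrmorphism A -> B}, g a = u -> g c = v -> g =1 f.

(* [horner_alg c h] is h(c). *)
Definition ispe_relations (k : fieldType) (h : {poly k}) (B : algType k)
    (a c d : B) : Prop :=
  [/\ a * c + c * a = 1, d * c + c * d = 1 & d * a + a * d = horner_alg c h].

(* P = k<a, c, d | ac + ca = 1, dc + cd = 1, da + ad = h(c)>. *)
Definition ispe_presentation (k : fieldType) (h : {poly k}) (P : algType k)
    (a c d : P) : Prop :=
  ispe_relations h a c d /\
  forall (B : algType k) (u v w : B), ispe_relations h u v w ->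
    exists f : {lrmorphism P -> B},
      [/\ f a = u, f c = v & f d = w] /\
      forall g : {lrmorphism P -> B}, g a = u -> g c = v -> g d = w -> g =1 f.

(* Main.v *)
Require Import Defs.
From HB Require Import structures.
From mathcomp Require Import all_boot all_order all_algebra.

Set Implicit Arguments.
Unset Strict Implicit.
Unset Printing Implicit Defensive.

Import GRing.Theory.
Local Open Scope ring_scope.

(** Write c for the generator of k[c].  Applying the involution tau to
    [a c = (q c) a + 1] gives [d c = (q c) d + 1], so sigma2 c = q c and
    delta2 c = 1 ([ispe_base]); everything then depends on the two unknown
    elements sigma2 a and delta2 a of A, say
    sigma2 a = sum_j s_j(c) a^j and delta2 a = sum_j g_j(c) a^j.

    Applying tau to [d a = sigma2(a) d + delta2(a)] gives
    [a d = sum_j s_j(c) d^j a + sum_j g_j(c) d^j].  Moving d^j past a gives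
    d^j a = sigma2^j(a) d^j plus terms of lower degree in d, so this becomes an
    identity between polynomials in d with coefficients in A ([ispe_swap]).
    - If n >= 2 bounds both degrees, the coefficient of d^n says that
      s_n sigma2^n(a) = - g_n lies in k[c].  But y = sigma2^n(a)
      satisfies y c' - q c' y = 1 with c' = sigma2^n(c) = q^n c, and no such y
      has a nonzero left k[c]-multiple in k[c] ([q_partner_not_torsion]); so
      s_n = g_n = 0, and both degrees are at most 1 ([sigma2_delta2_linear]).
    - The coefficients of d^1 and d^0 now give s_1^2 = 1, and
      the relation between sigma2 a and sigma2 c gives q s_1(0) = 1.  As
      q != 1, this leaves s_1 = -1 = q; the same relation then gives s_0 = 0,
      and the constant term gives delta2 a = g_0(c)
      ([ispe_quantum_weyl]).

    So the relations hold with h = g_0.  They present P because a map out of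
    R[x; sigma, delta] amounts to a map g out of R and an image w of x
    satisfying the commutation rule ([skew_lift]), and because the rule need
    only be tested on ring generators of R, which for R = A are a, c and the
    scalars. *)

(** * Skew polynomial rings *)

Section SkewPolynomials.

Variables (k : fieldType) (R S : algType k).
Variables (iota : {lrmorphism R -> S}) (x : S).
Variables (sigma : {rmorphism R -> R}) (delta : {linear R -> R}).
Hypothesis skewS : skew_poly_ring iota x sigma delta.

Definition skew_eval (p : {poly R}) : S := (map_poly iota p).[x].

Lemma skew_eval0 : skew_eval 0 = 0.
Proof. by rewrite /skew_eval raddf0 horner0. Qed.

Lemma skew_evalD p p' : skew_eval (p + p') = skew_eval p + skew_eval p'.
Proof. by rewrite /skew_eval rmorphD hornerD. Qed.

Lemma skew_evalC r : skew_eval r%:P = iota r.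
Proof. by rewrite /skew_eval map_polyC hornerC. Qed.

Lemma skew_evalMX p : skew_eval (p * 'X) = skew_eval p * x.
Proof. by rewrite /skew_eval rmorphM /= map_polyX hornerMX. Qed.

Lemma skew_evalCM r p : skew_eval (r%:P * p) = iota r * skew_eval p.
Proof. by rewrite /skew_eval rmorphM /= map_polyC hornerCM. Qed.

Lemma skew_eval_inj : injective skew_eval.
Proof. exact: bij_inj (skew_basis skewS). Qed.

Lemma skew_eval_surj t : exists p, t = skew_eval p.
Proof.
by have [f _ fK] := skew_basis skewS; exists (f t); rewrite /skew_eval fK.
Qed.

Lemma skew_iota_inj : injective iota.
Proof.
by move=> r s; rewrite -!skew_evalC => /skew_eval_inj/polyC_inj.
Qed.

Lemma skew_coef1_inj u v u' v' :
  iota u * x + iota v = iota u' * x + iota v' -> u = u' /\ v = v'.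
Proof.
rewrite -!skew_evalC -!skew_evalMX -!skew_evalD => /skew_eval_inj e.
split.
  have := congr1 (fun p : {poly R} => p`_1) e.
  by rewrite !coefD !coefMX !coefC /= !addr0.
have := congr1 (fun p : {poly R} => p`_0) e.
by rewrite !coefD !coefMX !coefC /= !add0r.
Qed.

(** Compare coefficients in [x * iota z%:A = iota z%:A * x]: scalars of S are
    central. *)
Lemma skew_scalar (z : k) : sigma z%:A = z%:A /\ delta z%:A = 0.
Proof.
apply: skew_coef1_inj; rewrite -(skew_comm skewS) rmorph0 addr0.
by rewrite linearZ rmorph1 -scalerAr mulr1 -scalerAl mul1r.
Qed.

Lemma skew_sigmaZ (z : k) r : sigma (z *: r) = z *: sigma r.
Proof.
rewrite -[in LHS](mul1r r) scalerAl rmorphM (skew_scalar z).1.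
by rewrite -scalerAl mul1r.
Qed.

(** Left multiplication by x, transported to coefficient polynomials. *)
Definition skew_lmulX (p : {poly R}) : {poly R} :=
  map_poly sigma p * 'X + map_poly delta p.

Lemma skew_eval_lmulX p : x * skew_eval p = skew_eval (skew_lmulX p).
Proof.
elim/poly_ind: p => [|p r IHp].
  by rewrite /skew_lmulX !raddf0 mul0r addr0 skew_eval0 mulr0.
have -> : skew_lmulX (p * 'X + r%:P) = skew_lmulX p * 'X + skew_lmulX r%:P.
  have dX : map_poly delta (p * 'X) = map_poly delta p * 'X.
    by apply/polyP=> -[|i]; rewrite !(coef_map, coefMX) /= ?raddf0.
  rewrite /skew_lmulX !raddfD /= dX rmorphM /= map_polyX !mulrDl.
  by rewrite -!addrA; congr (_ + _); rewrite addrCA.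
rewrite !skew_evalD !skew_evalMX -IHp mulrDr mulrA; congr (_ + _).
by rewrite [in LHS]skew_evalC (skew_comm skewS) !map_polyC !skew_evalC.
Qed.

Lemma skew_eval_iter_lmulX r n :
  x ^+ n * iota r = skew_eval (iter n skew_lmulX r%:P).
Proof.
elim: n => [|n IHn] /=; first by rewrite mul1r skew_evalC.
by rewrite exprS -mulrA IHn skew_eval_lmulX.
Qed.

Lemma size_iter_lmulX r n : (size (iter n skew_lmulX r%:P) <= n.+1)%N.
Proof.
elim: n => [|n /leq_sizeP IHn] /=; first exact: size_polyC_leq1.
apply/leq_sizeP=> -[//|i] lt_n_i; rewrite coefD coefMX !coef_map /=.
by rewrite !IHn ?raddf0 ?addr0 // ltnW.
Qed.

(** Together with [size_iter_lmulX]: [x ^+ n * r] is [sigma^n(r) * x ^+ n] plus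
    terms of lower degree. *)
Lemma coef_iter_lmulX r n :
  (iter n skew_lmulX r%:P)`_n = iter n sigma r.
Proof.
elim: n => [|n IHn] /=; first by rewrite coefC.
rewrite coefD coefMX !coef_map /= IHn nth_default ?raddf0 ?addr0 //.
exact: size_iter_lmulX.
Qed.

Lemma skew_eval_mulr (p : {poly R}) r n : (size p <= n)%N ->
  skew_eval p * iota r
    = skew_eval (\sum_(j < n) (p`_j)%:P * iter j skew_lmulX r%:P).
Proof.
move=> le_p_n; rewrite [skew_eval p](@horner_coef_wide _ n); last first.
  by apply: leq_trans le_p_n; apply: size_poly.
rewrite mulr_suml /skew_eval rmorph_sum horner_sum; apply: eq_bigr => j _.
by rewrite coef_map -mulrA skew_eval_iter_lmulX -skew_evalCM.
Qed.

Section UniversalProperty.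

Variables (B : algType k) (g : {lrmorphism R -> B}) (w : B).

(** The next three lemmas reduce the commutation rule of w with g to
    generators of R. *)
Lemma skew_comm_add r s :
    w * g r = g (sigma r) * w + g (delta r) ->
    w * g s = g (sigma s) * w + g (delta s) ->
  w * g (r + s) = g (sigma (r + s)) * w + g (delta (r + s)).
Proof. by move=> wr ws; rewrite !raddfD /= mulrDl mulrDr wr ws addrACA. Qed.

Lemma skew_comm_scalar (z : k) :
  w * g z%:A = g (sigma z%:A) * w + g (delta z%:A).
Proof.
have [-> ->] := skew_scalar z; rewrite linearZ /= rmorph0 rmorph1 addr0.
by rewrite -scalerAr -scalerAl mulr1 mul1r.
Qed.

Lemma skew_comm_mul r s :
    w * g r = g (sigma r) * w + g (delta r) ->
    w * g s = g (sigma s) * w + g (delta s) ->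
  w * g (r * s) = g (sigma (r * s)) * w + g (delta (r * s)).
Proof.
move=> wr ws; rewrite (skew_der skewS) !rmorphD !rmorphM /= mulrA wr mulrDl.
by rewrite -mulrA ws mulrDr !mulrA -addrA.
Qed.

Hypothesis w_comm : forall r, w * g r = g (sigma r) * w + g (delta r).

(** F sends [sum_i r_i x^i] to [sum_i g(r_i) w^i].  It turns left
    multiplication by elements of R and by x into left multiplication by their
    images, and R and x generate S; hence it is multiplicative. *)
Lemma skew_lift :
  exists f : {lrmorphism S -> B}, (forall r, f (iota r) = g r) /\ f x = w.
Proof.
pose G (p : {poly R}) := (map_poly g p).[w].
have [ev' evK' ev'K] := skew_basis skewS.
have evK p : ev' (skew_eval p) = p by exact: evK'.
pose F t := G (ev' t).
have Fev p : F (skew_eval p) = G p by rewrite /F evK.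
have GD p p' : G (p + p') = G p + G p' by rewrite /G rmorphD hornerD.
have GCM r p : G (r%:P * p) = g r * G p.
  by rewrite /G rmorphM /= map_polyC hornerCM.
have GMX p : G (p * 'X) = G p * w by rewrite /G rmorphM /= map_polyX hornerMX.
have GC r : G r%:P = g r by rewrite /G map_polyC hornerC.
have FD t u : F (t + u) = F t + F u.
  have [p ->] := skew_eval_surj t; have [p' ->] := skew_eval_surj u.
  by rewrite -skew_evalD !Fev GD.
have Fi r t : F (iota r * t) = g r * F t.
  by have [p ->] := skew_eval_surj t; rewrite -skew_evalCM !Fev GCM.
have Fx t : F (x * t) = w * F t.
  have [p ->] := skew_eval_surj t; rewrite skew_eval_lmulX !Fev.
  elim/poly_ind: p => [|p r IHp].
    by rewrite /skew_lmulX !raddf0 mul0r addr0 /G raddf0 horner0 mulr0.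
  have e q : G (skew_lmulX q) = F (x * skew_eval q).
    by rewrite skew_eval_lmulX Fev.
  rewrite e skew_evalD skew_evalC mulrDr FD skew_evalMX mulrA skew_eval_lmulX.
  rewrite -skew_evalMX Fev GMX IHp GD GMX GC mulrDr mulrA; congr (_ + _).
  rewrite (skew_comm skewS) -!skew_evalC -skew_evalMX FD !Fev GMX !GC.
  by rewrite w_comm.
have F0 : F 0 = 0 by rewrite -skew_eval0 Fev /G raddf0 horner0.
have F1 : F 1 = 1 by rewrite -(rmorph1 iota) /= -skew_evalC Fev GC rmorph1.
have FM t u : F (t * u) = F t * F u.
  have [p ->] := skew_eval_surj t.
  elim/poly_ind: p u => [|p r IHp] u.
    by rewrite skew_eval0 mul0r F0 mul0r.
  rewrite skew_evalD mulrDl !FD mulrDl skew_evalMX -mulrA !IHp Fx mulrA.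
  rewrite skew_evalC Fi; congr (_ * _ + _ * _).
    by rewrite -[x in RHS]mulr1 Fx F1 mulr1.
  by rewrite -skew_evalC Fev GC.
have FZ z t : F (z *: t) = z *: F t.
  rewrite -[t in LHS]mul1r scalerAl -(rmorph1 iota) -linearZ Fi linearZ rmorph1.
  by rewrite -scalerAl mul1r.
have F_lin : linear F by move=> z t u; rewrite FD FZ.
have F_mon : monoid_morphism F by split.
pose fL := GRing.isLinear.Build k S B *:%R F F_lin.
pose fM := GRing.isMonoidMorphism.Build S B F F_mon.
pose f : {lrmorphism S -> B} := HB.pack F fL fM.
exists f; split=> [r|]; first by rewrite -skew_evalC [LHS]Fev GC.
by rewrite -[x]mulr1 [LHS]Fx F1 mulr1.
Qed.

Lemma skew_lift_uniq (f f' : {rmorphism S -> B}) :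
  (forall r, f (iota r) = f' (iota r)) -> f x = f' x -> f =1 f'.
Proof.
move=> eq_iota eq_x t; have [p ->] := skew_eval_surj t.
elim/poly_ind: p => [|p r IHp]; first by rewrite skew_eval0 ?rmorph0.
rewrite skew_evalD skew_evalMX skew_evalC !rmorphD !rmorphM /=.
by rewrite IHp eq_iota eq_x.
Qed.

End UniversalProperty.

Lemma skew_ind (T : S -> Prop) :
    (forall t u, T t -> T u -> T (t + u)) ->
    (forall t u, T t -> T u -> T (t * u)) ->
    (forall r, T (iota r)) -> T x ->
  forall t, T t.
Proof.
move=> TD TM Ti Tx t; have [p ->] := skew_eval_surj t.
elim/poly_ind: p => [|p r IHp].
  by rewrite skew_eval0 -(rmorph0 iota); apply: Ti.
by rewrite skew_evalD skew_evalMX skew_evalC; apply: TD => //; apply: TM.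
Qed.

End SkewPolynomials.

(** * Involutive extensions of an arbitrary algebra *)

Section InvolutiveExtension.

Variables (k : fieldType) (R A S : algType k).
Variables (iA : {lrmorphism R -> A}) (a : A).
Variables (sigma1 : {rmorphism R -> R}) (delta1 : {linear R -> R}).
Variables (iS : {lrmorphism A -> S}) (d : S).
Variables (sigma2 : {rmorphism A -> A}) (delta2 : {linear A -> A}).
Hypothesis ispeS : ispe iA a sigma1 delta1 iS d sigma2 delta2.

(** The image under tau of the commutation rule of a is a commutation rule for
    d, and the latter is unique. *)
Lemma ispe_base r :
  sigma2 (iA r) = iA (sigma1 r) /\ delta2 (iA r) = iA (delta1 r).
Proof.
have [inA outS [tau [_ tau_a tau_d tau_R]]] := ispeS.
apply: (skew_coef1_inj outS); rewrite -(skew_comm outS).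
have /(congr1 (tau \o iS)) := skew_comm inA r.
by rewrite /= rmorphD !rmorphM /= rmorphD rmorphM /= !tau_R tau_a.
Qed.

(** tau maps [d a = sigma2(a) d + delta2(a)] to an expression of [a d] in which
    the powers of d stand left of a; [iter j (skew_lmulX _ _) a%:P] is [d^j a]
    with coefficients moved to the left of d. *)
Lemma ispe_swap (s g : {poly R}) n :
    sigma2 a = skew_eval iA a s -> delta2 a = skew_eval iA a g ->
    (size s <= n)%N ->
  a%:P * 'X
    = \sum_(j < n) (iA s`_j)%:P * iter j (skew_lmulX sigma2 delta2) a%:P
      + map_poly iA g.
Proof.
move=> sa da le_s_n; have [inA outS [tau [_ tau_a tau_d tau_R]]] := ispeS.
have tau_eval p : tau (iS (skew_eval iA a p)) = skew_eval iS d (map_poly iA p).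
  rewrite /skew_eval -horner_map -horner_map /= tau_a -!map_poly_comp.
  congr (_.[d]); apply: eq_map_poly => r /=; exact: tau_R.
apply: (skew_eval_inj outS); rewrite skew_evalMX skew_evalC skew_evalD.
have /(congr1 tau) := skew_comm outS a.
rewrite rmorphD !rmorphM /= sa da !tau_eval tau_a tau_d => ->.
rewrite (skew_eval_mulr outS a (n := n)) //; last first.
  exact: leq_trans (size_poly _ _) _.
by congr (skew_eval _ _ _ + _); apply: eq_bigr => j _; rewrite coef_map.
Qed.

End InvolutiveExtension.

(** * Involutive extensions over the quantum Weyl algebra *)

Section QuantumWeyl.

Variables (k : fieldType) (q : k).
Variables (A : algType k) (iA : {lrmorphism {poly k} -> A}) (a : A).
Variables (sigma1 : {rmorphism {poly k} -> {poly k}}).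
Variables (delta1 : {linear {poly k} -> {poly k}}).
Hypothesis skewA : skew_poly_ring iA a sigma1 delta1.

(** If f != 0, comparing degrees in a shows that y lies in k[c]; but then the
    left side of the q-commutator relation is a multiple of c. *)
Lemma q_partner_not_torsion (z : k) (y : A) (f g : {poly k}) :
    y * iA (z *: 'X) - q *: (iA (z *: 'X) * y) = 1 ->
  iA f * y = iA g -> f = 0.
Proof.
have [t ->] := skew_eval_surj skewA y => rel_y.
rewrite -skew_evalCM -(skew_evalC iA a) => /(skew_eval_inj skewA) ft.
apply: contra_eq (rel_y) => f_neq0.
have -> : t = (t`_0)%:P.
  apply/polyP=> -[|i]; rewrite coefC //=; apply/eqP.
  have /(congr1 (fun p : {poly {poly k}} => p`_i.+1)) := ft.
  by rewrite coefCM coefC => /eqP; rewrite mulf_eq0 (negPf f_neq0).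
rewrite skew_evalC -!rmorphM /= -linearZ -rmorphB -(rmorph1 iA).
rewrite (inj_eq (skew_iota_inj skewA)); apply/eqP=> /(congr1 (horner^~ 0)).
by move/eqP; rewrite !hornerE /= !mulr0 mul0r subr0 eq_sym oner_eq0.
Qed.

Variables (P : algType k) (iP : {lrmorphism A -> P}) (d : P).
Variables (sigma2 : {rmorphism A -> A}) (delta2 : {linear A -> A}).
Hypothesis ispeP : ispe iA a sigma1 delta1 iP d sigma2 delta2.
Hypotheses (sigma1_c : sigma1 'X = q *: 'X) (delta1_c : delta1 'X = 1).

Lemma weyl_relation : a * iA 'X - q *: (iA 'X * a) = 1.
Proof.
rewrite (skew_comm skewA) sigma1_c delta1_c rmorph1 linearZ -scalerAl.
by rewrite addrAC subrr add0r.
Qed.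

Lemma sigma2_iter_c n : iter n sigma2 (iA 'X) = iA (q ^+ n *: 'X).
Proof.
have outP := ispe_outer ispeP.
elim: n => [|n IHn] /=; first by rewrite scale1r.
rewrite IHn linearZ (skew_sigmaZ outP) (ispe_base ispeP _).1 sigma1_c.
by rewrite -linearZ scalerA -exprSr.
Qed.

Lemma sigma2_iter_relation n :
  iter n sigma2 a * iA (q ^+ n *: 'X)
    - q *: (iA (q ^+ n *: 'X) * iter n sigma2 a) = 1.
Proof.
have outP := ispe_outer ispeP.
rewrite -sigma2_iter_c; elim: n => [|n IHn] /=; first exact: weyl_relation.
by rewrite -!rmorphM -(skew_sigmaZ outP) -rmorphB IHn rmorph1.
Qed.

(** Descent on a common bound for the two degrees, by the coefficient of the
    highest power of d in [ispe_swap]: since n.+2 >= 2, the left side [a d] does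
    not contribute to it. *)
Lemma sigma2_delta2_linear (s g : {poly {poly k}}) :
    sigma2 a = skew_eval iA a s -> delta2 a = skew_eval iA a g ->
  (size s <= 2)%N /\ (size g <= 2)%N.
Proof.
move=> sa ga.
suff bound n :
    (size s <= n.+2 -> size g <= n.+2 -> size s <= 2 /\ size g <= 2)%N.
  apply: (bound (maxn (size s) (size g))).
    by apply: leq_trans (leq_maxl _ _) _; rewrite ltnW.
  by apply: leq_trans (leq_maxr _ _) _; rewrite ltnW.
elim: n => [|n IHn] // le_s le_g.
have /(congr1 (fun p : {poly A} => p`_n.+2)) := ispe_swap ispeP sa ga le_s.
have /= coefN := coef_iter_lmulX sigma2 delta2 a n.+2.
rewrite coefMX coefC coefD coef_sum coef_map big_ord_recr /= big1 => [|j _].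
  rewrite add0r coefCM coefN => /esym/eqP; rewrite addr_eq0 -rmorphN.
  move/eqP=> eq_top.
  have s0 := q_partner_not_torsion (sigma2_iter_relation n.+2) eq_top.
  have g0 : g`_n.+2 = 0.
    apply: (skew_iota_inj skewA); move: eq_top.
    by rewrite s0 !rmorph0 mul0r rmorphN => /esym/eqP; rewrite oppr_eq0 => /eqP.
  have size_le (p : {poly {poly k}}) :
      (size p <= n.+3)%N -> p`_n.+2 = 0 -> (size p <= n.+2)%N.
    move=> /leq_sizeP le_p p0; apply/leq_sizeP=> i.
    by rewrite leq_eqVlt => /predU1P[<-|/le_p].
  by apply: IHn; apply: size_le.
rewrite coefCM [X in _ * X]nth_default ?mulr0 //=.
exact: leq_trans (size_iter_lmulX _ _ _ _) (ltn_ord j).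
Qed.

Lemma ispe_quantum_weyl : q != 0 -> q != 1 ->
  q = -1 /\ exists h, sigma2 a = - a /\ delta2 a = iA h.
Proof.
move=> q_neq0 q_neq1.
have [s sa] := skew_eval_surj skewA (sigma2 a).
have [g ga] := skew_eval_surj skewA (delta2 a).
have [le_s le_g] := sigma2_delta2_linear sa ga.
have size2 (p : {poly {poly k}}) :
    (size p <= 2)%N -> p = (p`_1)%:P * 'X + (p`_0)%:P.
  move=> /leq_sizeP le_p; apply/polyP=> i; rewrite coefD coefMX !coefC /=.
  case: i => [|[|i]] /=.
  - by rewrite add0r.
  - by rewrite addr0.
  - by rewrite addr0 le_p.
have swap := ispe_swap ispeP sa ga le_s.
have lin (p : {poly {poly k}}) : (size p <= 2)%N ->
    skew_eval iA a p = iA p`_1 * a + iA p`_0.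
  by move/size2=> {1}->; rewrite skew_evalD skew_evalMX !skew_evalC.
have coef1 : a = iA s`_1 * sigma2 a + iA g`_1.
  move/(congr1 (fun p : {poly A} => p`_1)): swap.
  rewrite !big_ord_recl big_ord0 addr0 /= /skew_lmulX !map_polyC /=.
  rewrite !(coefD, coefMX, coefCM, coefC, coef_map) /= !mulr0 add0r !addr0.
  by [].
have coef0 : 0 = iA s`_0 * a + iA s`_1 * delta2 a + iA g`_0.
  move/(congr1 (fun p : {poly A} => p`_0)): swap.
  rewrite !big_ord_recl big_ord0 addr0 /= /skew_lmulX !map_polyC /=.
  rewrite !(coefD, coefMX, coefCM, coefC, coef_map) /= ?add0r.
  by [].
move: sa ga; rewrite !lin // => sa ga.
have [/esym s1s1 _] :
    1 = s`_1 * s`_1 /\ 0 = s`_1 * s`_0 + g`_1.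
  apply: (skew_coef1_inj skewA).
  rewrite !rmorph0 rmorph1 mul1r addr0 [LHS]coef1 sa.
  by rewrite mulrDr rmorphD !rmorphM addrA mulrA.
(* The two coefficients of sigma2 a * (q c) - q (q c) * sigma2 a = 1. *)
have [_ rel] : s`_1 * sigma1 (q *: 'X) - q *: (q *: 'X * s`_1) = 0
    /\ s`_1 * delta1 (q *: 'X) + s`_0 * (q *: 'X) - q *: (q *: 'X * s`_0) = 1.
  apply: (skew_coef1_inj skewA); rewrite rmorph0 mul0r add0r rmorph1.
  rewrite -(sigma2_iter_relation 1) /= expr1 sa mulrDl -[in RHS]mulrA.
  rewrite (skew_comm skewA) !mulrDr scalerDr !mulrA opprD.
  rewrite -[_ + _ + iA s`_0 * _]addrA [RHS]addrACA.
  have iAZ z p : iA (z *: p) = z *: iA p by rewrite linearZ.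
  move: (q *: 'X) => qX.
  by rewrite !(rmorphB, rmorphD, rmorphM) /= !iAZ !rmorphM mulrBl -scalerAl.
rewrite linearZ delta1_c /= in rel.
(* Evaluating at c = 0 removes the terms in s_0. *)
have s1_0 : q * (s`_1).[0] = 1.
  have := congr1 (horner^~ 0) rel.
  by rewrite !hornerE /= mulr1 !mulr0 mul0r addr0 subr0 mulrC.
have s1_const : s`_1 = 1 \/ s`_1 = -1.
  by apply/pred2P; rewrite -sqrf_eq1 expr2 s1s1.
case: s1_const => s1E; move: s1_0; rewrite s1E.
  by rewrite hornerC mulr1 => q1; rewrite q1 eqxx in q_neq1.
rewrite hornerN hornerC mulrN1 => /eqP; rewrite eqr_oppLR => /eqP qE.
(* With the terms in s_1 cancelling the 1, rel reads (1 - q) q c s_0 = 0. *)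
have s0E : s`_0 = 0.
  have qN : - (q *: 1) = 1 :> {poly k} by rewrite qE scaleN1r opprK.
  move: rel; rewrite s1E mulN1r qN -addrA => /(canRL (addKr _)).
  rewrite addNr mulrC -{1}[_ * _]scale1r -scalerBl => /eqP.
  rewrite scaler_eq0 subr_eq0 eq_sym (negPf q_neq1) mulf_eq0 scaler_eq0.
  by rewrite (negPf q_neq0) polyX_eq0 => /eqP.
split=> //; exists g`_0; split.
  by rewrite sa s1E s0E !rmorph0 addr0 rmorphN rmorph1 mulN1r.
move/esym/eqP: coef0; rewrite s1E s0E rmorph0 mul0r add0r rmorphN rmorph1.
by rewrite mulN1r addrC subr_eq0 => /eqP.
Qed.

End QuantumWeyl.


Theorem proposition5p1 (k : closedFieldType) (char0 : [pchar k] =i pred0)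
    (q : k) (q_neq0 : q != 0) (q_neq1 : q != 1)
    (A : algType k) (iA : {lrmorphism {poly k} -> A}) (a : A)
    (sigma1 : {rmorphism {poly k} -> {poly k}})
    (delta1 : {linear {poly k} -> {poly k}})
    (weylA : quantum_weyl q a (iA 'X))
    (sigma1_c : sigma1 'X = q *: 'X) (delta1_c : delta1 'X = 1)
    (P : algType k) (iP : {lrmorphism A -> P}) (d : P)
    (sigma2 : {rmorphism A -> A}) (delta2 : {linear A -> A})
    (ispeP : ispe iA a sigma1 delta1 iP d sigma2 delta2) :
  q = -1 /\
  exists h : {poly k}, ispe_presentation h (iP a) (iP (iA 'X)) d.
Proof.
have [inA outP _] := ispeP.
have [qE [h [sa da]]] :=
  ispe_quantum_weyl inA ispeP sigma1_c delta1_c q_neq0 q_neq1.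
split=> //; exists h.
have sc : sigma2 (iA 'X) = - iA 'X.
  by rewrite (ispe_base ispeP _).1 sigma1_c qE scaleN1r rmorphN.
have dc : delta2 (iA 'X) = 1.
  by rewrite (ispe_base ispeP _).2 delta1_c rmorph1.
have weyl_anti (B : algType k) (u v : B) :
    qweyl_relation q u v <-> u * v + v * u = 1.
  rewrite /qweyl_relation qE scaleN1r opprK.
  by split=> [/eqP|->]; rewrite ?subr_eq0 ?subrr // => /eqP.
split.
  split.
  - by have /weyl_anti/(congr1 iP) := weylA.1; rewrite rmorphD !rmorphM rmorph1.
  - by rewrite (skew_comm outP) sc dc rmorphN mulNr rmorph1 addrAC addNr add0r.
  - rewrite (skew_comm outP) sa da rmorphN mulNr addrAC addNr add0r.
    exact: (poly_alg_initial (iP \o iA)).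
move=> B u v w [uv wv wu].
have [g [[ga gc] g_uniq]] := weylA.2 B u v (iffRL (weyl_anti _ _ _) uv).
have giA p : g (iA p) = horner_alg v p.
  by rewrite -gc; apply: (poly_alg_initial (g \o iA)).
have w_c : w * g (iA 'X) = g (sigma2 (iA 'X)) * w + g (delta2 (iA 'X)).
  by rewrite sc dc rmorphN mulNr rmorph1 /= gc -wv addrCA addNr addr0.
have w_a : w * g a = g (sigma2 a) * w + g (delta2 a).
  by rewrite sa da rmorphN mulNr /= giA ga -wu addrCA addNr addr0.
have w_comm r : w * g r = g (sigma2 r) * w + g (delta2 r).
  elim/(skew_ind inA): r => // [r s|r s|p]; first exact: skew_comm_add.
    exact: (skew_comm_mul outP).
  elim/poly_ind: p => [|p z IHp]; first by rewrite !raddf0 mulr0 mul0r addr0.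
  rewrite rmorphD rmorphM; apply: skew_comm_add.
    exact: (skew_comm_mul outP).
  by rewrite /= -alg_polyC linearZ /= rmorph1; apply: (skew_comm_scalar outP).
have [f [f_iP f_d]] := skew_lift outP w_comm.
exists f; split; first by rewrite !f_iP ga gc.
move=> f' f'a f'c f'd; apply: (skew_lift_uniq outP); last by rewrite /= f_d.
by move=> r; rewrite /= f_iP; apply: (g_uniq (f' \o iP)).
Qed.
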